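(* Let $R$ be a principal ideal domain, let $n>2$, let $a_1,\dots,a_n\in R$ satisfy $Ra_1+\cdots+Ra_n=R$ with $a_1\neq 0$, let $S=\{(x_1,\dots,x_n)\in R^n : a_1x_1+\cdots+a_nx_n=0\}$, and let $p\in R$ be a prime. Let $$d_i=\frac{a_1\,(a_1,\dots,a_{i+1})}{(a_1,a_{i+1})\,(a_1,\dots,a_i)},\qquad 2\leq i\leq n-1.$$ Then the $p$-elementary divisors of the $R$-module $S/U_1$ are given by the $p$-parts of $d_2,\dots,d_{n-1}$ (trivial $p$-parts being disregarded). Moreover, $$S/U_1\cong R/Rd_2\oplus\cdots\oplus R/Rd_{n-1}.$$
   Context: $(r_1,\dots,r_t)$ denotes a greatest common divisor of $r_1,\dots,r_t\in R$ (determined up to units). For $j\neq 1$, $v(1,j)\in S$ is the vector whose first entry is $-a_j$, whose $j$th entry is $a_1$, and whose other entries are $0$; $u(1,j)=v(1,j)/(a_1,a_j)\in S$. $U_1$ is the $R$-submodule of $S$ spanned by $u(1,2),\dots,u(1,n)$. The $p$-part of a nonzero element $d\in R$ is the highest power of $p$ dividing $d$. The $p$-elementary divisors of a finitely generated torsion $R$-module $Q$ are the prime powers $p^{s}$, $s\geq1$ (with multiplicity) occurring in a decomposition of the $p$-component of $Q$ as a direct sum of modules $R/Rp^{s}$. *)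

(* Defs.v *)
From HB Require Import structures.
From mathcomp Require Import all_boot all_algebra generic_quotient.
From mathcomp Require Import boolp classical_sets.
From mathcomp Require Import ring.

Set Implicit Arguments.
Unset Strict Implicit.
Unset Printing Implicit Defensive.

Import GRing.Theory.
Local Open Scope ring_scope.
Local Open Scope quotient_scope.

Section Span.
Variables (R : pzRingType) (M : lmodType R).

Definition Rspan (us : seq M) : {pred M} :=
  fun x => `[< exists c : 'I_(size us) -> R,
                 x = \sum_(i < size us) c i *: us`_i >].

Lemma RspanP us x :
  reflect (exists c : 'I_(size us) -> R, x = \sum_(i < size us) c i *: us`_i)
          (x \in Rspan us).
Proof. exact: asboolP. Qed.

Lemma Rspan_submod_closed us : submod_closed (Rspan us).
Proof.
split=> [|r _ _ /RspanP[c ->] /RspanP[e ->]]; apply/RspanP.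
  by exists (fun=> 0); rewrite big1// => i _; rewrite scale0r.
exists (fun i => r * c i + e i); rewrite scaler_sumr -big_split/=.
by apply: eq_bigr => i _; rewrite scalerDl scalerA.
Qed.

HB.instance Definition _ us :=
  GRing.isSubmodClosed.Build R M (Rspan us) (Rspan_submod_closed us).

Definition fin_gen := exists us : seq M, forall x, x \in Rspan us.

End Span.

(* Ideals are the submodules of the regular module R^o; in particular
   Rspan [:: d : R^o] is the principal ideal R d.  Boolean predicates lose no
   generality because the logic is classical. *)
Definition is_pid (R : idomainType) :=
  forall I : {pred R^o}, submod_closed I -> exists d : R^o, I =i Rspan [:: d].

Section Arithmetic.
Variable R : idomainType.

Definition rdvd (d x : R) := exists c, x = c * d.

Definition is_gcd (s : seq R) (g : R) :=
  (forall x, x \in s -> rdvd g x) /\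
  (forall h, (forall x, x \in s -> rdvd h x) -> rdvd h g).

Definition prime_elt (p : R) :=
  [/\ p != 0, p \isn't a GRing.unit &
      forall x y, rdvd p (x * y) -> rdvd p x \/ rdvd p y].

Definition ppart (p d : R) : R :=
  xget 1 [set q | exists2 k, q = p ^+ k & rdvd q d /\ ~ rdvd (p ^+ k.+1) d].

Definition torsion (M : lmodType R) :=
  forall x : M, exists2 r : R, r != 0 & r *: x = 0.

(* v / r in an R-module.  The quotient is unique when r != 0 and the module is
   torsion-free; the value is 0 when r does not divide v. *)
Definition exquo (M : lmodType R) (v : M) (r : R) : M :=
  xget 0 [set w : M | r *: w = v].

End Arithmetic.

(* The library makes {quot U} a Z-module; this gives it its R-module
   structure. *)
Section QuotientModule.
Variables (R : pzRingType) (M : lmodType R) (U : submodClosed M).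

Fact submod_zmod_closed : zmod_closed (U : {pred M}).
Proof.
split=> [|x y Ux Uy]; first exact: rpred0.
by rewrite -scaleN1r rpredD// rpredZ.
Qed.

Definition submod_zmod : zmodClosed M :=
  HB.pack_for (zmodClosed M) (GRing.SubmodClosed.sort U)
    (GRing.isZmodClosed.Build M (GRing.SubmodClosed.sort U) submod_zmod_closed).

Definition quotmod := Quotient.quot submod_zmod.
HB.instance Definition _ := GRing.Zmodule.on quotmod.

Definition quotmod_pi : M -> quotmod := \pi_(Quotient.quot submod_zmod).

Definition quotmod_scale (r : R) (x : quotmod) : quotmod :=
  quotmod_pi (r *: repr (x : Quotient.quot submod_zmod)).

Lemma quotmod_piP x y : (quotmod_pi x = quotmod_pi y) <-> (x - y \in U).
Proof.
have -> : (x - y \in U) = (x - y \in submod_zmod) by [].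
by rewrite Quotient.idealrBE; split=> /eqP.
Qed.

Lemma quotmod_pi_surj (x : quotmod) : quotmod_pi (repr (x : Quotient.quot submod_zmod)) = x.
Proof. exact: reprK. Qed.

Lemma quotmod_piZ r x : quotmod_scale r (quotmod_pi x) = quotmod_pi (r *: x).
Proof.
apply/quotmod_piP; rewrite -scalerBr rpredZ//.
by apply/quotmod_piP; rewrite quotmod_pi_surj.
Qed.

Lemma quotmod_piD x y : quotmod_pi (x + y) = quotmod_pi x + quotmod_pi y.
Proof. exact: Quotient.pi_add. Qed.

Fact quotmod_scaleA r s (x : quotmod) :
  quotmod_scale r (quotmod_scale s x) = quotmod_scale (r * s) x.
Proof. by rewrite -[x]quotmod_pi_surj !quotmod_piZ scalerA. Qed.

Fact quotmod_scale1 : left_id 1 quotmod_scale.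
Proof. by move=> x; rewrite -[x]quotmod_pi_surj quotmod_piZ scale1r. Qed.

Fact quotmod_scaleDr : right_distributive quotmod_scale +%R.
Proof.
move=> r x y; rewrite -[x]quotmod_pi_surj -[y]quotmod_pi_surj.
by rewrite -quotmod_piD !quotmod_piZ scalerDr quotmod_piD.
Qed.

Fact quotmod_scaleDl (x : quotmod) :
  {morph quotmod_scale^~ x : r s / r + s}.
Proof.
move=> r s; rewrite -[x]quotmod_pi_surj !quotmod_piZ.
by rewrite scalerDl quotmod_piD.
Qed.

HB.instance Definition _ := GRing.Zmodule_isLmodule.Build R quotmod
  quotmod_scaleA quotmod_scale1 quotmod_scaleDr quotmod_scaleDl.

Fact quotmod_pi_is_linear : linear quotmod_pi.
Proof. by move=> r x y; rewrite quotmod_piD -quotmod_piZ. Qed.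

HB.instance Definition _ :=
  GRing.isLinear.Build R M quotmod _ quotmod_pi quotmod_pi_is_linear.

End QuotientModule.

Section DirectSum.
Variables (R : pzRingType) (I : finType) (M : I -> lmodType R).

Definition dirsum := {dffun forall i : I, M i}.
HB.instance Definition _ := Choice.on dirsum.
Implicit Types f g h : dirsum.

Definition dirsum0 : dirsum := [ffun i => 0 : M i].
Definition dirsum_opp f : dirsum := [ffun i => - f i].
Definition dirsum_add f g : dirsum := [ffun i => f i + g i].
Definition dirsum_scale (r : R) f : dirsum := [ffun i => r *: f i].

Fact dirsum_addA : associative dirsum_add.
Proof. by move=> f g h; apply/ffunP => i; rewrite !ffunE addrA. Qed.
Fact dirsum_addC : commutative dirsum_add.
Proof. by move=> f g; apply/ffunP => i; rewrite !ffunE addrC. Qed.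
Fact dirsum_add0 : left_id dirsum0 dirsum_add.
Proof. by move=> f; apply/ffunP => i; rewrite !ffunE add0r. Qed.
Fact dirsum_addN : left_inverse dirsum0 dirsum_opp dirsum_add.
Proof. by move=> f; apply/ffunP => i; rewrite !ffunE addNr. Qed.

HB.instance Definition _ := GRing.isZmodule.Build dirsum
  dirsum_addA dirsum_addC dirsum_add0 dirsum_addN.

Fact dirsum_scaleA r s f :
  dirsum_scale r (dirsum_scale s f) = dirsum_scale (r * s) f.
Proof. by apply/ffunP => i; rewrite !ffunE scalerA. Qed.
Fact dirsum_scale1 : left_id 1 dirsum_scale.
Proof. by move=> f; apply/ffunP => i; rewrite !ffunE scale1r. Qed.
Fact dirsum_scaleDr : right_distributive dirsum_scale +%R.
Proof. by move=> r f g; apply/ffunP => i; rewrite !ffunE scalerDr. Qed.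
Fact dirsum_scaleDl f : {morph dirsum_scale^~ f : r s / r + s}.
Proof. by move=> r s; apply/ffunP => i; rewrite !ffunE scalerDl. Qed.

HB.instance Definition _ := GRing.Zmodule_isLmodule.Build R dirsum
  dirsum_scaleA dirsum_scale1 dirsum_scaleDr dirsum_scaleDl.

End DirectSum.

Definition isomod (R : pzRingType) (M N : lmodType R) :=
  exists f : {linear M -> N}, bijective f.

Definition cyclic_sum (R : idomainType) (ds : seq R) :=
  dirsum (fun i : 'I_(size ds) => quotmod (Rspan [:: ds`_i : R^o])).

Section PComponent.
Variables (R : idomainType) (p : R) (M : lmodType R).

Definition pcomp_pred : {pred M} := fun x => `[< exists k, p ^+ k *: x = 0 >].

Fact pcomp_submod_closed : submod_closed pcomp_pred.
Proof.
split=> [|r x y /asboolP[k hx] /asboolP[l hy]]; apply/asboolP.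
  by exists 0%N; rewrite scaler0.
exists (k + l)%N.
have -> : p ^+ (k + l) *: (r *: x + y) =
    (p ^+ l * r) *: (p ^+ k *: x) + p ^+ k *: (p ^+ l *: y).
  by rewrite scalerDr !scalerA exprD -mulrA mulrC.
by rewrite hx hy !scaler0 addr0.
Qed.

HB.instance Definition _ :=
  GRing.isSubmodClosed.Build R M pcomp_pred pcomp_submod_closed.

Record pcomp := Pcomp { pcomp_val : M; _ : pcomp_val \in pcomp_pred }.

HB.instance Definition _ := [isSub for pcomp_val].
HB.instance Definition _ := [Choice of pcomp by <:].
HB.instance Definition _ := [SubChoice_isSubLmodule of pcomp by <:].

End PComponent.

(* es lists the p-elementary divisors p ^ s, s >= 1, of Q with multiplicity;
   the order of the list is irrelevant. *)
Definition elementary_divisors (R : idomainType) (p : R) (Q : lmodType R)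
    (es : seq R) :=
  [/\ fin_gen Q, torsion Q,
      exists2 s : seq nat, all (leq 1) s & es = [seq p ^+ k | k <- s]
    & isomod (pcomp p Q) (cyclic_sum es)].

(* The tuple a is indexed from 0: a`_i is the coefficient written a_{i+1}. *)
Section Syzygies.
Variables (R : idomainType) (n : nat) (a : n.-tuple R).

Definition syz_pred : {pred 'rV[R]_n} :=
  fun x => \sum_(i < n) a`_i * x 0 i == 0.

Fact syz_submod_closed : submod_closed syz_pred.
Proof.
split=> [|r x y /eqP hx /eqP hy]; apply/eqP.
  by rewrite big1// => i _; rewrite mxE mulr0.
transitivity (r * (\sum_(i < n) a`_i * x 0 i) + \sum_(i < n) a`_i * y 0 i).
  rewrite mulr_sumr -big_split; apply: eq_bigr => i _ /=.
  by rewrite !mxE mulrDr mulrCA.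
by rewrite hx hy mulr0 addr0.
Qed.

HB.instance Definition _ :=
  GRing.isSubmodClosed.Build R 'rV[R]_n syz_pred syz_submod_closed.

Record syz := Syz { syz_val : 'rV[R]_n; _ : syz_val \in syz_pred }.

HB.instance Definition _ := [isSub for syz_val].
HB.instance Definition _ := [Choice of syz by <:].
HB.instance Definition _ := [SubChoice_isSubLmodule of syz by <:].

(* For j > 0: entry 0 is - a`_j, entry j is a`_0, the others are 0. *)
Definition v1_row (j : 'I_n) : 'rV[R]_n :=
  \row_(k < n) (a`_0 *+ (k == j) - a`_j *+ (k == 0 :> nat)).

Fact v1_row_syz j : v1_row j \in syz_pred.
Proof.
have j0 : (0 < n)%N by exact: leq_ltn_trans (ltn_ord j).
apply/eqP; under eq_bigr do rewrite mxE mulrBr !mulrnAr.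
rewrite sumrB (bigD1 j)//= big1 ?addr0 => [|i /negPf ->//].
rewrite (bigD1 (Ordinal j0))//= big1 ?addr0 => [|i].
  by rewrite eqxx !mulr1n mulrC subrr.
by rewrite -val_eqE/= => /negPf ->.
Qed.

Definition v1 (j : 'I_n) : syz := Syz (v1_row_syz j).

(* gcd selects a greatest common divisor of every finite list. *)
Variable gcd : seq R -> R.

Definition u1 (j : 'I_n) : syz := exquo (v1 j) (gcd [:: a`_0; a`_j]).

Definition U1 : {pred syz} :=
  Rspan [seq u1 j | j : 'I_n <- enum 'I_n & (0 < j)%N].
HB.instance Definition _ := GRing.SubmodClosed.on U1.

(* The number d_i, for 2 <= i <= n - 1; take i a lists a_1, ..., a_i. *)
Definition d_ (i : nat) : R :=
  exquo (a`_0 * gcd (take i.+1 a) : R^o)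
        (gcd [:: a`_0; a`_i] * gcd (take i a)).

End Syzygies.

Arguments U1 {R n} a gcd _.

(* The divisions in the definitions of u1 and d_ are exact. *)
Section ExactDivision.
Variable R : idomainType.
Implicit Types (s : seq R) (x d g h : R).

Lemma Rspan1P (M : lmodType R) (v x : M) :
  reflect (exists c : R, x = c *: v) (x \in Rspan [:: v]).
Proof.
apply: (iffP (RspanP _ _)) => [[c ->]|[c ->]].
  by exists (c ord0); rewrite big_ord_recl big_ord0 addr0.
by exists (fun=> c); rewrite big_ord_recl big_ord0 addr0.
Qed.

Lemma mem_Rspan (M : lmodType R) (us : seq M) u : u \in us -> u \in Rspan us.
Proof.
move=> uus; have ui : (index u us < size us)%N by rewrite index_mem.
apply/RspanP; exists (fun i => (i == Ordinal ui)%:R).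
rewrite (bigD1 (Ordinal ui))//= eqxx scale1r nth_index// big1 ?addr0//.
by move=> i /negPf ->; rewrite scale0r.
Qed.

Lemma gcd_Rspan s g : is_pid R -> is_gcd s g -> (g : R^o) \in Rspan (s : seq R^o).
Proof.
move=> /(_ _ (Rspan_submod_closed (s : seq R^o)))[d sd] [_ gmax].
rewrite sd; apply/Rspan1P; apply: gmax => x xs.
by apply/(@Rspan1P R^o); rewrite -sd mem_Rspan.
Qed.

Lemma exquoP (M : lmodType R) (v : M) (r : R) :
  (exists w, r *: w = v) -> r *: exquo v r = v.
Proof. exact: xgetPex. Qed.

Variables (gcd : seq R -> R) (n : nat) (a : n.-tuple R).
Hypotheses (gcdP : forall s, is_gcd s (gcd s)) (a0 : a`_0 != 0).

Lemma u1_exact (j : 'I_n) : gcd [:: a`_0; a`_j] *: u1 a gcd j = v1 a j.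
Proof.
set g := gcd _.
have [c cE] : rdvd g a`_0 by apply: (gcdP _).1; rewrite mem_head.
have [e eE] : rdvd g a`_j by apply: (gcdP _).1; rewrite !inE eqxx orbT.
have g0 : g != 0 by apply: contra_neq a0 => g0; rewrite cE g0 mulr0.
pose w : 'rV[R]_n := \row_(k < n) (c *+ (k == j) - e *+ (k == 0 :> nat)).
have gw : g *: w = v1_row a j.
  by apply/rowP => k; rewrite !mxE mulrBr !mulrnAr !(mulrC g) -cE -eE.
have wS : w \in syz_pred a.
  apply/eqP/(mulfI g0); rewrite mulr0 mulr_sumr -[RHS](eqP (v1_row_syz a j)).
  by apply: eq_bigr => k _; rewrite -gw !mxE mulrCA.
by apply: exquoP; exists (Syz wS); apply/val_inj.
Qed.

Lemma d_exact (i : nat) : is_pid R -> (0 < i < n)%N ->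
  gcd [:: a`_0; a`_i] * gcd (take i a) * d_ a gcd i =
  a`_0 * gcd (take i.+1 a).
Proof.
move=> pidR /andP[i0 iltn].
set g := gcd [:: _; _]; set h := gcd (take i a); set h' := gcd _.
have [c cE] : rdvd g a`_0 by apply: (gcdP _).1; rewrite mem_head.
have [e eE] : rdvd g a`_i by apply: (gcdP _).1; rewrite !inE eqxx orbT.
have hP x : x \in take i a -> rdvd h x by move: x; exact: (gcdP _).1.
have [f fE] : rdvd h a`_0.
  by apply: hP; rewrite -(nth_take 0 i0) mem_nth// size_take size_tuple iltn.
have dvd x : x \in take i.+1 a -> rdvd (g * h) (a`_0 * x).
  rewrite (take_nth 0) ?size_tuple// mem_rcons inE => /predU1P[->|/hP[y ->]].
    by exists (f * e); rewrite eE fE; ring.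
  by exists (c * y); rewrite cE; ring.
apply: (@exquoP R^o).
have /RspanP[k kE] := gcd_Rspan pidR (gcdP (take i.+1 a)).
have /choice[q qE] (l : 'I_(size (take i.+1 a))) :
    exists q, a`_0 * (take i.+1 a)`_l = q * (g * h) by exact/dvd/mem_nth.
exists (\sum_l k l * q l); rewrite /h' kE !mulr_sumr scaler_sumr.
by apply: eq_bigr => l _; rewrite mulrCA qE /GRing.scale/=; ring.
Qed.

End ExactDivision.

(* Main.v *)
Require Import Defs.
From HB Require Import structures.
From mathcomp Require Import all_boot all_algebra.
From mathcomp Require Import boolp classical_sets.
From mathcomp Require Import ring.

(* Write g_i for the gcd of a_1, ..., a_i and c_j = a_1 / (a_1, a_j).  As
   a_1 <> 0, an element of S is determined by its coordinates other than the
   first, so U_1 consists of the x in S such that c_j divides x_j for all j > 1.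
   Let t be a Bezout vector for g_i, supported on the first i coordinates, and
     w_i = (g_i / g_(i+1)) e_(i+1) - (a_(i+1) / g_(i+1)) t.
   The last coordinates of the elements of S supported on the first i + 1
   coordinates are the multiples of g_i / g_(i+1), so the w_i generate S modulo
   U_1.  Moreover d_i g_i / g_(i+1) = c_(i+1), and d_i w_i lies in U_1 because
   c_j divides a_1 / g_i for j <= i.  Descending on the last coordinate, a
   combination of the w_i lies in U_1 only if each coefficient is a multiple of
   d_i: the w_i split S / U_1 as the direct sum of the R / R d_i for i >= 1, and
   d_1 is a unit. *)

Set Implicit Arguments.
Unset Strict Implicit.
Unset Printing Implicit Defensive.

Import GRing.Theory.
Local Open Scope ring_scope.

(** * Modules that split as direct sums of cyclic submodules *)

Section CyclicDecomposition.
Variable R : idomainType.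
Implicit Types (M : lmodType R) (s : seq nat) (D : nat -> R).

Lemma quotmod_pi_rdvd (d x y : R) :
  quotmod_pi (Rspan [:: d : R^o]) (x : R^o)
    = quotmod_pi (Rspan [:: d : R^o]) (y : R^o) <-> rdvd d (x - y).
Proof.
by split=> [/quotmod_piP/Rspan1P //|dxy]; apply/quotmod_piP/Rspan1P.
Qed.

(* The family W, indexed by s, splits M as the direct sum of the R W_i, with
   R D_i the annihilator of W_i. *)
Definition cyclic_decomposition M s D (W : nat -> M) :=
  [/\ forall x, exists r : nat -> R, x = \sum_(i <- s) r i *: W i,
      forall r : nat -> R, \sum_(i <- s) r i *: W i = 0 ->
        {in s, forall i, rdvd (D i) (r i)}
    & {in s, forall i, D i *: W i = 0}].

(** The coefficients [c x i] are chosen arbitrarily, but independence determines them modulo [D i].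
    Their classes therefore depend linearly on [x] and give the isomorphism. *)
Lemma cyclic_decomposition_isomod M s D (W : nat -> M) :
  uniq s -> cyclic_decomposition s D W -> isomod M (cyclic_sum (map D s)).
Proof.
move=> us [/choice[c cE] ind ann].
have lts (i : 'I_(size (map D s))) : (i < size s)%N.
  by rewrite -(size_map D) ltn_ord.
have c_kernel x y z (r : R) : z = r *: x + y ->
    {in s, forall i, rdvd (D i) (c z i - (r * c x i + c y i))}.
  move=> zE; apply: (ind (fun i => c z i - (r * c x i + c y i))).
  transitivity (z - (r *: x + y)); last by rewrite zE subrr.
  rewrite {2}[z]cE {2}[x]cE {2}[y]cE scaler_sumr -big_split -sumrB /=.
  by apply: eq_bigr => i _; rewrite scalerBl scalerDl scalerA.
pose F (x : M) : cyclic_sum (map D s) :=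
  [ffun i : 'I_(size (map D s)) =>
     quotmod_pi (Rspan [:: (map D s)`_i : R^o]) (c x (nth 0%N s i) : R^o)].
have linF : linear F.
  move=> r x y; apply/ffunP => i; rewrite !ffunE -linearP.
  apply/quotmod_pi_rdvd; rewrite (nth_map 0%N)//.
  exact: c_kernel (erefl (r *: x + y)) _ (mem_nth 0%N (lts i)).
pose linFm := GRing.isLinear.Build R M (cyclic_sum (map D s)) _ F linF.
pose G : {linear M -> cyclic_sum (map D s)} := HB.pack F linFm.
have GF x : G x = F x by [].
have injF : injective F.
  move=> x y Fxy; rewrite [x]cE [y]cE; apply/eqP.
  rewrite -subr_eq0 -sumrB; apply/eqP/big1_seq => k /andP[_ sk].
  have ks : (index k s < size (map D s))%N by rewrite size_map index_mem.
  have /(congr1 (fun f : cyclic_sum (map D s) => f (Ordinal ks))) := Fxy.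
  rewrite !ffunE /= (nth_map 0%N) ?index_mem// nth_index//.
  case/quotmod_pi_rdvd => q.
  by rewrite -scalerBl => ->; rewrite -scalerA ann// scaler0.
have surjF f : exists x, F x = f.
  have /choice[q qE] (i : 'I_(size (map D s))) : exists q : R^o,
      quotmod_pi (Rspan [:: (map D s)`_i : R^o]) q = f i.
    by eexists; exact: quotmod_pi_surj.
  (* Moves coefficients from positions in [s] to entries of [s]; this inverts [nth] because [s] has
     no repetition. *)
  pose r k : R := oapp q 0 (insub (index k s)).
  exists (\sum_(k <- s) r k *: W k); apply/ffunP => i; rewrite ffunE -qE.
  set x := \sum_(k <- s) _; apply/quotmod_pi_rdvd; rewrite (nth_map 0%N)//.
  have -> : q i = r (nth 0%N s i).
    rewrite /r index_uniq// insubT//= => lt; congr q; exact: val_inj.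
  apply: (ind (fun k => c x k - r k)); last exact/mem_nth.
  by under eq_bigr do rewrite scalerBl; rewrite sumrB -cE subrr.
have /choice[H HK] := surjF.
by exists G, H => [x|f]; rewrite GF ?HK//; apply: injF; rewrite HK.
Qed.

(** A unit that kills [W i] forces [W i = 0]. This serves to discard the index 1. *)
Lemma cyclic_decomposition_behead M i s D (W : nat -> M) :
  D i \is a GRing.unit -> i \notin s ->
  cyclic_decomposition (i :: s) D W -> cyclic_decomposition s D W.
Proof.
move=> Di i_s [gen ind ann].
have Wi : W i = 0.
  by rewrite -(scale1r (W i)) -(mulVr Di) -scalerA ann ?scaler0// mem_head.
split=> [x|r rW k sk|k sk].
- by have [r ->] := gen x; exists r; rewrite big_cons Wi scaler0 add0r.
- by apply: ind; rewrite ?big_cons ?Wi ?scaler0 ?add0r// inE sk orbT.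
- by apply: ann; rewrite inE sk orbT.
Qed.

Lemma cyclic_decomposition_fin_gen M s D (W : nat -> M) :
  cyclic_decomposition s D W -> fin_gen M.
Proof.
move=> [gen _ _]; exists (map W s) => x.
have [r ->] := gen x; rewrite big_seq rpred_sum// => i si.
by rewrite rpredZ// mem_Rspan// map_f.
Qed.

Lemma cyclic_decomposition_torsion M s D (W : nat -> M) :
  {in s, forall i, D i != 0} -> cyclic_decomposition s D W -> torsion M.
Proof.
move=> D0 [gen _ ann] x; exists (\prod_(i <- s) D i).
  by rewrite prodf_seq_neq0; apply/allP => i si; rewrite D0.
have [r ->] := gen x; rewrite scaler_sumr big1_seq// => i /andP[_ si].
rewrite scalerA (big_rem i)//= -mulrA mulrC.
by rewrite -scalerA ann ?scaler0.
Qed.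


End CyclicDecomposition.

(** * Prime parts and the [p]-component *)

Section PrimePart.
Variables (R : idomainType) (pidR : is_pid R) (p : R) (hp : prime_elt p).

(* Assume that p^k divides d for all k.  The x such that d divides some p^k x
   form an ideal; if g generates it, then p^k g = u d for some k and u, and
   d = p^(k+1) z g for some z, so that p is a unit. *)
Lemma prime_power_ndvd d : d != 0 -> exists k, ~ rdvd (p ^+ k) d.
Proof.
move=> d0; apply/existsNP => pd; have [p0 pU _] := hp.
pose I : {pred R^o} := fun x => `[< exists k, rdvd d (p ^+ k * x) >].
have [|g Ig] := pidR (I := I).
  split=> [|r x y /asboolP[k [u uE]] /asboolP[l [v vE]]]; apply/asboolP.
    by exists 0%N, 0; rewrite mulr0 mul0r.
  exists (k + l)%N, (p ^+ l * r * u + p ^+ k * v).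
  rewrite [X in _ * X](_ : _ = r * x + y)// mulrDl -!mulrA -uE -vE exprD.
  ring.
have /asboolP[k [u uE]] : g \in I by rewrite Ig mem_Rspan// mem_head.
have [q dE] := pd k.+1.
have /Rspan1P[z qE] : (q : R^o) \in Rspan [:: g].
  rewrite -Ig; apply/asboolP; exists k.+1, 1; by rewrite mul1r mulrC -dE.
have {}qE : q = z * g by [].
move/negP: pU; apply; apply/unitrPr; exists (z * u).
apply: (mulIf d0); rewrite mul1r -!mulrA -uE [RHS]dE qE exprS; ring.
Qed.

Lemma ppartP d : d != 0 -> exists k, [/\ ppart p d = p ^+ k,
  rdvd (p ^+ k) d & ~ rdvd (p ^+ k.+1) d].
Proof.
move=> d0; have [k0 Hk0] := prime_power_ndvd d0.
(* The least exponent whose power fails to divide [d] is positive, since [p ^+ 0] divides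
   everything; its predecessor is the exponent sought. *)
have /ex_minnP[[|k] /asboolP ndvd kmin] :
    exists k, `[< ~ rdvd (p ^+ k) d >] by exists k0; exact/asboolP.
  by case: ndvd; exists d; rewrite mulr1.
have dvd : rdvd (p ^+ k) d.
  by apply: contrapT => /asboolP/kmin; rewrite ltnn.
have : exists q, [set q : R | exists2 k, q = p ^+ k
    & rdvd q d /\ ~ rdvd (p ^+ k.+1) d]%classic q by exists (p ^+ k), k.
by move=> /(xgetPex 1)[l lE [dvdl ndvdl]]; exists l; split; rewrite -?lE.
Qed.

(** Let [g] generate the ideal of [p] and [e], with [p = c * g]. If [p] divides [c], then [g] is a
    unit; if [p] divides [g], it divides [e]. Powers follow by multiplying Bezout identities. *)
Lemma prime_coprime e k : ~ rdvd p e -> exists u v, u * p ^+ k + v * e = 1.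
Proof.
move=> pe; have [p0 pU pP] := hp.
have [u [v uv]] : exists u v, u * p + v * e = 1.
  have [g gE] := pidR (Rspan_submod_closed [:: p : R^o; e : R^o]).
  have /Rspan1P[c cE] : (p : R^o) \in Rspan [:: g].
    by rewrite -gE mem_Rspan// mem_head.
  have /Rspan1P[f fE] : (e : R^o) \in Rspan [:: g].
    by rewrite -gE mem_Rspan// !inE eqxx orbT.
  have {}cE : p = c * g by [].
  have {}fE : e = f * g by [].
  have [|[c' c'E]|[g' g'E]] := pP c g.
  - by exists 1; rewrite -cE mul1r.
  - have : g \in Rspan [:: p : R^o; e : R^o] by rewrite gE mem_Rspan// mem_head.
    move=> /RspanP[w]; rewrite 2!big_ord_recl big_ord0 addr0 /=.
    set w0 := w _; set w1 := w _ => wE.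
    have {}wE : g = w0 * p + w1 * e by [].
    exists (c' * w0), (c' * w1).
    apply: (mulIf p0); rewrite mul1r [RHS]cE c'E [in RHS]wE; ring.
  - by case: pe; exists (f * g'); rewrite fE g'E mulrA.
elim: k => [|k [u' [v' uv']]]; first by exists 1, 0; rewrite expr0; ring.
exists (u * u'), (u * p * v' + v * u' * p ^+ k + v * v' * e).
transitivity ((u * p + v * e) * (u' * p ^+ k + v' * e)).
  by rewrite exprS; ring.
by rewrite uv uv' mulr1.
Qed.

(** Multiply a Bezout identity for [p ^+ l] and [e] by [r]: both terms become multiples of [e]. *)
Lemma coprime_prime_power_rdvd d e l r : ~ rdvd p e ->
  rdvd e d -> rdvd d (p ^+ l * r) -> rdvd e r.
Proof.
move=> /(@prime_coprime _ l)[u [v uv]] [f ->] [q qE].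
exists (u * q * f + v * r).
by rewrite -[LHS]mul1r -uv mulrDl -mulrA qE; ring.
Qed.

(* Writing D_i = p^k_i E_i with p not dividing E_i, the p-component of R / D_i
   is generated by E_i. *)
Lemma pcomp_cyclic_decomposition (M : lmodType R) (s : seq nat) (D : nat -> R)
    (W : nat -> M) :
  {in s, forall i, D i != 0} -> cyclic_decomposition s D W ->
  exists W' : nat -> Defs.pcomp p M,
    cyclic_decomposition [seq i <- s | ppart p (D i) != 1]
      (fun i => ppart p (D i)) W'.
Proof.
move=> D0 [gen ind ann].
have /choice[E EP] i :
    exists e, i \in s -> D i = e * ppart p (D i) /\ ~ rdvd p e.
  have [si|] := boolP (i \in s); last by exists 0.
  have [k [-> [e eE] ndvd]] := ppartP (D0 _ si).
  exists e => _; split=> // -[f fE].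
  by apply: ndvd; exists f; rewrite eE fE exprS mulrA.
have E0 i : i \in s -> E i != 0.
  move=> si; apply: contraNneq (D0 _ si) => e0.
  by have [-> _] := EP _ si; rewrite e0 mul0r.
(* For [i] in [s] the power [ppart p (D i)] kills [E i *: W i], so the default 0 does not occur
   there. *)
pose W' i : Defs.pcomp p M := insubd 0 (E i *: W i).
have W'E i : i \in s -> val (W' i) = E i *: W i.
  move=> si; rewrite insubdK//; apply/asboolP.
  have [k [kE _ _]] := ppartP (D0 _ si); exists k.
  by rewrite scalerA -kE mulrC -(EP _ si).1 ann.
have W'0 i : i \in s -> ppart p (D i) *: W' i = 0.
  move=> si; apply: val_inj.
  by rewrite linearZ /= W'E// scalerA mulrC -(EP _ si).1 ann.
have sumE (r : nat -> R) :
    val (\sum_(i <- [seq i <- s | ppart p (D i) != 1]) r i *: W' i) =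
    \sum_(i <- s) (r i * E i) *: W i.
  rewrite raddf_sum big_filter [RHS](bigID (fun i => ppart p (D i) != 1)) /=.
  (* If the [p]-part of [D i] is 1, then [E i = D i] kills [W i], so the filtered-out terms
     vanish. *)
  rewrite [X in _ = _ + X]big1_seq ?addr0; last first.
    move=> i /andP[/negPn/eqP P1 si]; rewrite -scalerA.
    by have [] := EP _ si; rewrite P1 mulr1 => <- _; rewrite ann ?scaler0.
  rewrite [LHS]big_seq_cond [RHS]big_seq_cond; apply: eq_bigr => i /andP[si _].
  by rewrite -scalerA -W'E.
exists W'; split=> [x|r /(congr1 val)|i].
(* Some [p ^+ l] kills [x], so [D i] divides [p ^+ l * r i]; hence [E i] divides [r i]. *)
- have [r rE] := gen (val x).
  have /asboolP[l lE] := valP x.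
  have /choice[q qE] i : exists q, i \in s -> r i = q * E i.
    have [si|] := boolP (i \in s); last by exists 0.
    have [DE pE] := EP i si.
    have [] // := @coprime_prime_power_rdvd (D i) (E i) l (r i) pE.
    + by exists (ppart p (D i)); rewrite mulrC.
    + apply: (ind (fun i => p ^+ l * r i)) => //.
      rewrite -[RHS]lE rE scaler_sumr.
      by apply: eq_bigr => j _; rewrite scalerA.
    + by move=> q ->; exists q.
  exists q; apply: val_inj; rewrite sumE rE.
  by apply: eq_big_seq => i si; rewrite qE.
- rewrite sumE => /ind dvd i; rewrite mem_filter => /andP[_ si].
  have [q qE] := dvd i si; exists q; apply: (mulIf (E0 i si)).
  by rewrite qE {1}(EP i si).1 /=; ring.
- by rewrite mem_filter => /andP[_ si]; exact: W'0.
Qed.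

(** Removing the entries equal to 1 removes exactly the exponents 0, because a positive power of the
    nonunit [p] is never 1. *)
Lemma ppart_prime_powers (ds : seq R) : {in ds, forall d, d != 0} ->
  exists2 s, all (leq 1) s &
    [seq q <- map (ppart p) ds | q != 1] = [seq p ^+ k | k <- s].
Proof.
elim: ds => [|d ds IH] ds0; first by exists [::].
have [|s s1 sE] := IH; first by move=> x xds; rewrite ds0// inE xds orbT.
have [|[|k] [kE _ _]] := @ppartP d; first by rewrite ds0// mem_head.
  by exists s; rewrite //= kE eqxx.
exists (k.+1 :: s); rewrite //= kE sE ifT//.
have [_ pU _] := hp; apply: contraNneq pU => p1.
by apply/unitrPr; exists (p ^+ k); rewrite -exprS.
Qed.

Lemma cyclic_decomposition_elementary_divisors (M : lmodType R) (s : seq nat)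
    (D : nat -> R) (W : nat -> M) :
  uniq s -> {in s, forall i, D i != 0} -> cyclic_decomposition s D W ->
  elementary_divisors p M
    [seq q <- [seq ppart p d | d <- map D s] | q != 1].
Proof.
move=> us D0 cW; split.
- exact: cyclic_decomposition_fin_gen cW.
- exact: cyclic_decomposition_torsion cW.
- by apply: ppart_prime_powers => _ /mapP[i si ->]; exact: D0.
have [W' cW'] := pcomp_cyclic_decomposition D0 cW.
rewrite -map_comp filter_map.
exact: cyclic_decomposition_isomod (filter_uniq _ us) cW'.
Qed.

End PrimePart.

(** * The syzygy module [S] and its quotient by [U_1] *)

Section Syzygy.
Variables (R : idomainType) (pidR : is_pid R).
Variables (gcd : seq R -> R) (gcdP : forall s : seq R, is_gcd s (gcd s)).
Variables (n : nat) (a : n.-tuple R) (a0 : a`_0 != 0).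
Variables (c : nat -> R) (cE : forall j, a`_0 = c j * gcd [:: a`_0; a`_j]).

Let n_gt0 : (0 < n)%N.
Proof.
by rewrite lt0n -(size_tuple a); apply: contra_neq a0 => /size0nil ->.
Qed.

Lemma gcd_dvd (s : seq R) x : x \in s -> rdvd (gcd s) x.
Proof. by move: x; exact: (gcdP s).1. Qed.

Lemma gcd_neq0 (s : seq R) : a`_0 \in s -> gcd s != 0.
Proof.
move=> /gcd_dvd[q qE].
by apply: contra_neq a0 => g0; rewrite qE g0 mulr0.
Qed.

Lemma mem_take_nth i j : (j < i)%N -> (j < n)%N -> a`_j \in take i a.
Proof.
move=> ji jn; rewrite -(nth_take 0 ji) mem_nth// size_take_min size_tuple.
by rewrite leq_min ji.
Qed.

Lemma bezout_row i : (i <= n)%N -> exists t : 'rV[R]_n,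
  (forall j : 'I_n, (i <= j)%N -> t 0 j = 0) /\
  \sum_(j < n) a`_j * t 0 j = gcd (take i a).
Proof.
move=> ile; have sz : size (take i a) = i by rewrite size_takel ?size_tuple.
have /RspanP[k kE] := gcd_Rspan pidR (gcdP (take i a)).
(* Bezout coefficients of the first [i] entries, extended by zero. *)
pose r j : R := oapp k 0 (insub j).
exists (\row_j r j); split=> [j ij|].
  by rewrite mxE /r insubN// sz -leqNgt.
have -> : gcd (take i a) = \sum_(j < size (take i a)) a`_j * r j.
  rewrite kE; apply: eq_bigr => j _; rewrite /r valK /= mulrC.
  by rewrite nth_take// -[X in (_ < X)%N]sz.
rewrite (big_ord_widen n (fun j => a`_j * r j)) ?sz// [RHS]big_mkcond /=.
apply: eq_bigr => j _; rewrite mxE; case: ltnP => // ij.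
by rewrite /r insubN ?mulr0// sz -leqNgt.
Qed.

Lemma syzP (x : syz a) : \sum_(i < n) a`_i * val x 0 i = 0.
Proof. exact/eqP/(valP x). Qed.

Lemma syz_sumE (I : Type) (s : seq I) (P : pred I) (r : I -> R)
    (x : I -> syz a) j :
  val (\sum_(i <- s | P i) r i *: x i) 0 j =
  \sum_(i <- s | P i) r i * val (x i) 0 j.
Proof.
rewrite raddf_sum summxE; apply: eq_bigr => i _.
exact: (mxE _ _ 0 j).
Qed.

Lemma syz_inj (x y : syz a) :
  (forall j : 'I_n, (0 < j)%N -> val x 0 j = val y 0 j) -> x = y.
Proof.
move=> xy; apply/val_inj/rowP => j.
have [j0|] := posnP j; last exact: xy.
have : \sum_(i < n) a`_i * val x 0 i = \sum_(i < n) a`_i * val y 0 i.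
  by rewrite !syzP.
rewrite (bigD1 j)//= [RHS](bigD1 j)//= j0.
rewrite (eq_bigr (fun i : 'I_n => a`_i * val y 0 i)).
  by move=> /addIr /(mulfI a0).
move=> i ij; rewrite -xy// lt0n; apply: contra_neq ij => i0.
by apply/val_inj; rewrite /= j0 i0.
Qed.

Lemma u1E (j k : 'I_n) : (0 < k)%N ->
  val (u1 a gcd j) 0 k = c j *+ (k == j).
Proof.
move=> k0; have g0 : gcd [:: a`_0; a`_j] != 0 by rewrite gcd_neq0// mem_head.
apply: (mulfI g0).
have /(congr1 (fun x : syz a => val x 0 k)) := u1_exact gcdP a0 j.
rewrite linearZ !mxE /= => ->.
by rewrite (gtn_eqF k0) mulr0n subr0 mulrnAr mulrC -cE.
Qed.

(** Away from position 0, [u1 a gcd j] is [c j] times a unit vector, so the quotients of [val x 0 j]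
    by [c j] serve as coefficients; position 0 then agrees by [syz_inj]. *)
Lemma U1P (x : syz a) :
  x \in U1 a gcd <-> forall j : 'I_n, (0 < j)%N -> rdvd (c j) (val x 0 j).
Proof.
split=> [/RspanP[r ->] j j0|dvd].
  set us := [seq _ | _ <- _ & _].
  have /choice[q qE] i : exists q, i \in us -> val i 0 j = q * c j.
    have [|] := boolP (i \in us); last by exists 0.
    case/mapP => k _ ->; exists (j == k)%:R => _; rewrite u1E//.
    by case: eqP => [->|]; rewrite ?mul1r ?mul0r.
  exists (\sum_(i < size us) r i * q us`_i).
  rewrite syz_sumE mulr_suml; apply: eq_bigr => i _.
  by rewrite -mulrA -qE// mem_nth.
have /choice[y yE] (j : 'I_n) : exists q, (0 < j)%N -> val x 0 j = q * c j.
  case: (posnP j) => [->|/dvd[q ->]]; first by exists 0.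
  by exists q.
have -> : x = \sum_(j < n | (0 < j)%N) y j *: u1 a gcd j.
  apply: syz_inj => j j0; rewrite syz_sumE (bigD1 j)//=.
  rewrite u1E// eqxx -yE// big1 ?addr0// => k /andP[_ kj].
  by rewrite u1E// eq_sym (negPf kj) mulr0.
apply: rpred_sum => j j0; apply: rpredZ; apply: mem_Rspan.
by rewrite map_f// mem_filter j0 mem_enum.
Qed.

(* Indices start from 0, so that w is the w_o of the header, with last
   coordinate in position o. *)
Lemma syz_step (o : 'I_n) : (0 < o)%N -> exists w : syz a,
  [/\ forall j : 'I_n, (o < j)%N -> val w 0 j = 0,
      c o = d_ a gcd o * val w 0 o,
      forall j : 'I_n, (0 < j < o)%N -> rdvd (c j) (d_ a gcd o * val w 0 j)
    & forall x : syz a, (forall j : 'I_n, (o < j)%N -> val x 0 j = 0) ->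
        rdvd (val w 0 o) (val x 0 o)].
Proof.
move=> o0.
have [t [t0 tE]] := bezout_row (ltnW (ltn_ord o)).
have [t' [t'0 t'E]] := bezout_row (ltn_ord o).
have DE := d_exact a gcdP pidR (introT andP (conj o0 (ltn_ord o))).
move: tE t'E DE; set g := gcd (take o a); set g' := gcd (take o.+1 a).
set D := d_ a gcd o; set G := gcd _ => tE t'E DE.
have g0 : g != 0 by rewrite gcd_neq0// mem_take_nth.
have g'0 : g' != 0 by rewrite gcd_neq0// mem_take_nth.
have G0 : G != 0 by rewrite gcd_neq0// mem_head.
have ga (j : 'I_n) : (j < o)%N -> rdvd g a`_j.
  by move=> jo; apply: gcd_dvd; exact: mem_take_nth.
have [h hE] : rdvd g' g.
  apply: (gcdP (take o a)).2 => x xa; apply: gcd_dvd.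
  by rewrite (take_nth 0) ?size_tuple// mem_rcons inE xa orbT.
have [b bE] : rdvd g' a`_o by apply: gcd_dvd; exact: mem_take_nth.
have [f fE] : rdvd G a`_o by apply: gcd_dvd; rewrite !inE eqxx orbT.
have h0 : h != 0 by apply: contra_neq g0 => h0; rewrite hE h0 mul0r.
(* The positions before [o] contribute a multiple of [g], which divides their coefficients. *)
have dotE (x : 'rV[R]_n) : (forall j : 'I_n, (o < j)%N -> x 0 j = 0) ->
    exists y, \sum_(j < n) a`_j * x 0 j = a`_o * x 0 o + y * g.
  move=> x0; have /choice[q qE] (j : 'I_n) :
      exists q, (j < o)%N -> a`_j = q * g.
    case: (ltnP j o) => [/ga[q ->]|_]; last by exists 0.
    by exists q.
  exists (\sum_(j < n | j != o) q j * x 0 j).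
  rewrite (bigD1 o)//=; congr (_ + _); rewrite mulr_suml.
  apply: eq_bigr => j jo; rewrite mulrAC.
  have [/qE <- //|oj] := ltnP j o.
  by rewrite x0 ?mulr0 ?mul0r// ltn_neqAle eq_sym val_eqE jo.
(* [b] and [h] are coprime: divide the Bezout identity for [g'] by [g']. *)
have [s sE] : exists s, b * t' 0 o + s * h = 1.
  have [s] := dotE t' t'0; rewrite t'E => sE; exists s.
  by apply: (mulIf g'0); rewrite mul1r [RHS]sE bE hE; ring.
pose w : 'rV[R]_n := h *: delta_mx 0 o - b *: t.
have wE j : w 0 j = h *+ (j == o) - b * t 0 j.
  by rewrite !mxE eqxx /= mulr_natr.
have wS : w \in syz_pred a.
  apply/eqP; under eq_bigr do rewrite wE mulrBr.
  rewrite sumrB (bigD1 o)//= big1 ?addr0; last first.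
    by move=> j /negPf ->; rewrite mulr0n mulr0.
  rewrite eqxx mulr1n (eq_bigr (fun j : 'I_n => b * (a`_j * t 0 j))).
    by rewrite -mulr_sumr tE bE hE; ring.
  by move=> j _; rewrite mulrCA.
have woE : w 0 o = h by rewrite wE eqxx t0// mulr0 subr0.
exists (Syz wS); split=> /=.
- move=> j oj; rewrite wE t0 ?(ltnW oj)// mulr0 subr0 -val_eqE /=.
  by rewrite (gtn_eqF oj).
- rewrite woE; apply: (mulIf G0); rewrite -cE; apply: (mulIf g'0).
  by rewrite -DE hE; ring.
- move=> j /andP[j0 jo]; rewrite wE -val_eqE /= (ltn_eqF jo) mulr0n sub0r.
  have [e eE] : rdvd g (gcd [:: a`_0; a`_j]).
    apply: (gcdP [:: a`_0; a`_j]).2 => x; rewrite !inE => /orP[]/eqP ->.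
      by apply: gcd_dvd; exact: mem_take_nth.
    exact: ga.
  exists (- (e * f * t 0 j)).
  suff -> : D * (- (b * t 0 j)) = - ((D * b) * t 0 j).
    (* Both sides times [G * g * g'] equal [a_o * a_0 * g'], up to the factor [g'] already common to
       both: by [DE] on the left, by the factorizations on the right. *)
    suff -> : D * b = c j * e * f by ring.
    apply: (mulIf (mulf_neq0 G0 (mulf_neq0 g0 g'0))).
    transitivity (a`_o * (G * g * D)); first by rewrite bE; ring.
    by rewrite DE {1}fE (cE j) eE; ring.
  by ring.
- move=> x x0; have [y] := dotE _ x0; rewrite syzP woE => yE.
  (* [h] divides [b * val x 0 o]; as [b] and [h] are coprime, it divides [val x 0 o]. *)
  have bx : b * val x 0 o = - y * h.
    apply: (mulIf g'0); apply/eqP; rewrite -subr_eq0 [X in _ == X]yE bE hE.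
    by apply/eqP; ring.
  exists (- y * t' 0 o + s * val x 0 o).
  rewrite mulrDl mulrAC -bx -[LHS]mul1r -sE; ring.
Qed.

Lemma d_neq0 i : (0 < i < n)%N -> d_ a gcd i != 0.
Proof.
move=> i0n; have [i0 ilt] := andP i0n.
have := mulf_neq0 a0 (gcd_neq0 (mem_take_nth (ltn0Sn i) n_gt0)).
apply: contraTneq => d0.
by rewrite -(d_exact a gcdP pidR i0n) d0 mulr0 eqxx.
Qed.

(** The gcds of the first two entries cancel, leaving [a_0] over a gcd of [a_0] alone. *)
Lemma d1_unit : (1 < n)%N -> d_ a gcd 1 \is a GRing.unit.
Proof.
move=> n1; have := d_exact a gcdP pidR (introT andP (conj (ltnSn 0) n1)).
have sz := size_tuple a.
have -> : take 1 a = [:: a`_0].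
  by rewrite (take_nth 0) ?sz// take0.
have -> : take 2 a = [:: a`_0; a`_1].
  by rewrite !(take_nth 0) ?sz// take0.
have G0 : gcd [:: a`_0; a`_1] != 0 by rewrite gcd_neq0// mem_head.
have [e ->] : rdvd a`_0 (gcd [:: a`_0]).
  by apply: (gcdP _).2 => x; rewrite inE => /eqP->; exists 1; rewrite mul1r.
move=> dE; apply/unitrPr; exists e.
by apply: (mulfI (mulf_neq0 a0 G0)); rewrite mulr1 -[RHS]dE; ring.
Qed.

Lemma syz_cyclic_decomposition : exists W : nat -> quotmod (U1 a gcd),
  cyclic_decomposition (index_iota 1 n) (d_ a gcd) W.
Proof.
have /choice[w wP] (o : 'I_n) : exists w : syz a, (0 < o)%N ->
  [/\ forall j : 'I_n, (o < j)%N -> val w 0 j = 0,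
      c o = d_ a gcd o * val w 0 o,
      forall j : 'I_n, (0 < j < o)%N -> rdvd (c j) (d_ a gcd o * val w 0 j)
    & forall x : syz a, (forall j : 'I_n, (o < j)%N -> val x 0 j = 0) ->
        rdvd (val w 0 o) (val x 0 o)].
  by case: (posnP o) => [->|/syz_step[w wP]]; [exists 0|exists w].
have scaleE r (x : syz a) j : val (r *: x) 0 j = r * val x 0 j.
  exact: (mxE _ _ 0 j).
have subE (x y : syz a) j : val (x - y) 0 j = val x 0 j - val y 0 j.
  by rewrite !mxE.
have dwU (o : 'I_n) : (0 < o)%N -> d_ a gcd o *: w o \in U1 a gcd.
  move=> o0; have [w0 coE dvd _] := wP o o0; apply/U1P => j j0.
  rewrite scaleE; case: (ltngtP j o) => [jo|oj|/val_inj ->].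
  - by apply: dvd; rewrite j0.
  - by exists 0; rewrite w0// mulr0 mul0r.
  - by exists 1; rewrite -coE mul1r.
have c0 (o : 'I_n) : c o != 0.
  by apply: contra_neq a0 => co; rewrite (cE o) co mul0r.
(* Induction on the last position allowed to be nonzero: subtracting a multiple of [w o] clears
   position [o = k.+1]. For [k = 0] all positions but the first vanish, so [x] is in [U1]. *)
have gen k : forall x : syz a, (forall j : 'I_n, (k < j)%N -> val x 0 j = 0) ->
    exists r : 'I_n -> R,
      x - \sum_(o < n | (0 < o)%N) r o *: w o \in U1 a gcd.
  elim: k => [|k IH] x x0.
    exists (fun=> 0); rewrite big1 ?subr0 => [|o _]; last by rewrite scale0r.
    by apply/U1P => j /x0 ->; exists 0; rewrite mul0r.
  have [nk|kn] := leqP n k.+1.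
    apply: IH => j kj; suff : (j < k.+1)%N by rewrite ltnNge kj.
    exact: leq_trans nk.
  pose o := Ordinal kn; have [w0 _ _ wdvd] := wP o (ltn0Sn k).
  have [q qE] := wdvd x x0.
  have [|r rU] := IH (x - q *: w o).
    move=> j kj; rewrite subE scaleE.
    have [oj|jo|/(@val_inj _ _ _ o j) <-] := ltngtP o j.
    - by rewrite x0// w0// mulr0 subrr.
    - by move: kj; rewrite ltnNge -ltnS jo.
    - by rewrite qE subrr.
  exists (fun i => r i + q *+ (i == o)).
  suff -> : \sum_(i < n | (0 < i)%N) (r i + q *+ (i == o)) *: w i
      = q *: w o + \sum_(i < n | (0 < i)%N) r i *: w i by rewrite opprD addrA.
  rewrite (bigD1 o)//= [in RHS](bigD1 o)//= eqxx scalerDl addrCA -addrA.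
  congr (_ + (_ + _)); apply: eq_bigr => i /andP[_ /negPf ->].
  by rewrite mulr0n addr0.
(* At the last position [o] only [r o *: w o] contributes, so [c o = d_o * val (w o) 0 o] divides
   [r o * val (w o) 0 o]. Cancel, then remove this term, which is in [U1], and descend. *)
have ind k : forall r : 'I_n -> R, (forall j : 'I_n, (k < j)%N -> r j = 0) ->
    \sum_(o < n | (0 < o)%N) r o *: w o \in U1 a gcd ->
    forall o : 'I_n, (0 < o)%N -> rdvd (d_ a gcd o) (r o).
  elim: k => [|k IH] r r0 rU.
    by move=> o /r0 ->; exists 0; rewrite mul0r.
  have [nk|kn] := leqP n k.+1.
    apply: IH rU => j kj; suff : (j < k.+1)%N by rewrite ltnNge kj.
    exact: leq_trans nk.
  pose o := Ordinal kn; have [_ coE _ _] := wP o (ltn0Sn k).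
  have wo0 : val (w o) 0 o != 0.
    by apply: contra_neq (c0 o) => wo; rewrite coE wo mulr0.
  have [q qE] : rdvd (d_ a gcd o) (r o).
    have /U1P/(_ o (ltn0Sn k))[q] := rU.
    rewrite syz_sumE (bigD1 o)//= big1 ?addr0 => [|i /andP[i0 io]]; last first.
      have [oi|io'|/val_inj iE] := ltngtP o i; last by rewrite -iE eqxx in io.
        by rewrite r0 ?mul0r.
      by have [w0 _ _ _] := wP i i0; rewrite w0 ?mulr0.
    rewrite {1}coE => rE; exists q; apply: (mulIf wo0).
    by rewrite rE mulrA.
  have {}IH := IH (fun i => if i == o then 0 else r i).
  move=> i i0; have [->|io] := eqVneq i o; first by exists q.
  have := IH _ _ i i0; rewrite (negPf io); apply=> [j kj|].
    case: eqVneq => // jo; apply: r0; rewrite ltn_neqAle kj andbT.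
    by apply: contra_neq jo => oj; apply: val_inj.
  have -> : \sum_(j < n | (0 < j)%N) (if j == o then 0 else r j) *: w j =
      \sum_(j < n | (0 < j)%N) r j *: w j + (- q) *: (d_ a gcd o *: w o).
    rewrite scalerA mulNr -qE scaleNr (bigD1 o)//= [in RHS](bigD1 o)//=.
    rewrite eqxx scale0r add0r addrAC subrr add0r.
    by apply: eq_bigr => j /andP[_ /negPf ->].
  by rewrite rpredD// rpredZ// dwU.
pose W i := quotmod_pi (U1 a gcd) (oapp w 0 (insub i)).
have sumE (r : nat -> R) : \sum_(i <- index_iota 1 n) r i *: W i =
    quotmod_pi (U1 a gcd) (\sum_(o < n | (0 < o)%N) r o *: w o).
  rewrite big_geq_mkord linear_sum; apply: eq_bigr => o _.
  by rewrite linearZ /W valK.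
have pi0 x : quotmod_pi (U1 a gcd) x = 0 <-> x \in U1 a gcd.
  rewrite -[X in _ = X](linear0 (quotmod_pi (U1 a gcd))).
  by rewrite quotmod_piP subr0.
exists W; split=> [x|r|i].
- rewrite -[x]quotmod_pi_surj; set y := repr _.
  (* With the bound [n] the vanishing condition is vacuous. *)
  have [|r rU] := gen n y; first by move=> j; rewrite ltnNge ltnW.
  exists (fun i => oapp r 0 (insub i)); rewrite sumE.
  apply/quotmod_piP; rewrite (eq_bigr (fun o => r o *: w o))// => o _.
  by rewrite valK.
- rewrite sumE => /pi0 rU i; rewrite mem_index_iota => /andP[i0 iltn].
  apply: (ind n (fun o => r o) _ rU (Ordinal iltn) i0) => j.
  by rewrite ltnNge ltnW.
- rewrite mem_index_iota => /andP[i0 iltn].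
  rewrite /W -linearZ; apply/pi0.
  by rewrite (insubT (fun i => i < n)%N iltn); exact: (dwU (Ordinal iltn)).
Qed.

End Syzygy.

Theorem theorem5p4 (R : idomainType) (pidR : is_pid R)
  (gcd : seq R -> R) (gcdP : forall s : seq R, is_gcd s (gcd s))
  (n : nat) (hn : (2 < n)%N) (a : n.-tuple R)
  (ha : forall r : R^o, r \in Rspan (a : seq R^o)) (ha1 : a`_0 != 0)
  (p : R) (hp : prime_elt p) :
  let Q := quotmod (U1 a gcd) in
  let ds := [seq d_ a gcd i | i <- index_iota 2 n] in
  elementary_divisors p Q [seq q <- [seq ppart p d | d <- ds] | q != 1]
  /\ isomod Q (cyclic_sum ds).
Proof.
move=> Q ds.
have /choice[c cE] j : exists c, a`_0 = c * gcd [:: a`_0; a`_j].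
  by apply: (gcdP _).1; rewrite mem_head.
have n1 : (1 < n)%N := ltnW hn.
have [W] := syz_cyclic_decomposition pidR gcdP ha1 cE.
(* The index 1 is split off because [d_1] is a unit and its summand is zero. *)
have -> : index_iota 1 n = 1%N :: index_iota 2 n.
  by rewrite /index_iota -(subnSK n1).
move/cyclic_decomposition_behead => cW.
have {}cW : cyclic_decomposition (index_iota 2 n) (d_ a gcd) W.
  by apply: cW; [apply: d1_unit | rewrite mem_index_iota].
have us : uniq (index_iota 2 n) by exact: iota_uniq.
split; last exact: cyclic_decomposition_isomod cW.
apply: cyclic_decomposition_elementary_divisors cW => // i.
rewrite mem_index_iota => /andP[i1 iltn].
by apply: d_neq0; rewrite ?iltn ?(ltnW i1).
Qed.
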